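(* Let $d\ge 2$, $\mu\in\mathcal{M}$, $\lambda>0$ and $p\ge1$. If $\gamma:[0,L]\to\mathbb{R}^d$ is an arc-length-parameterized minimizer of $E_\mu^{\lambda,p}$ over $\mathcal{C}$, then $\gamma'\in BV([0,L],\mathbb{R}^d)$ and $$\|\gamma'\|_{TV([0,L])}\le \frac{p}{\lambda}\,\bigl(\operatorname{diam}(\operatorname{supp}(\mu))\bigr)^{p-1}\,\mu(\mathbb{R}^d).$$
   Context: $\mathcal{M}$ denotes the set of positive, finite, compactly supported measures $\mu$ on $\mathbb{R}^d$ with $\mu(\mathbb{R}^d)>0$. $\mathcal{C}$ denotes the set of all curves $\gamma:[0,a]\to\mathbb{R}^d$, with $a\ge 0$ arbitrary (depending on the curve; $a=0$ is allowed and gives a single point), that are Lipschitz with $|\gamma'|\le 1$ a.e. For $\gamma\in\mathcal{C}$ with domain $[0,a]$, put $\Gamma_\gamma=\gamma([0,a])$, let the length $L(\gamma)$ be the total variation of $\gamma$ on $[0,a]$, and let $d(x,\Gamma_\gamma)=\inf_{y\in\Gamma_\gamma}|x-y|$. For $\mu\in\mathcal{M}$, $\lambda>0$, $p\ge1$, $$E_\mu^{\lambda,p}(\gamma)=\int_{\mathbb{R}^d} d(x,\Gamma_\gamma)^p\,d\mu(x)+\lambda L(\gamma),\qquad \gamma\in\mathcal{C}.$$ A minimizer of $E_\mu^{\lambda,p}$ is a curve in $\mathcal{C}$ attaining $\inf_{\mathcal{C}}E_\mu^{\lambda,p}$. A curve $\gamma:[0,L]\to\mathbb{R}^d$ in $\mathcal{C}$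 is arc-length parameterized if $|\gamma'|=1$ a.e. on $[0,L]$ (so $L=L(\gamma)$). $\|\cdot\|_{TV([0,L])}$ denotes the total variation on $[0,L]$ of an $\mathbb{R}^d$-valued function (of the a.e.-defined function $\gamma'$, understood in the sense of $BV$ functions). *)

(* Defs.v *)
From mathcomp Require Import all_boot all_order all_algebra.
From mathcomp Require Import all_classical all_reals all_analysis.
Import Order.TTheory GRing.Theory Num.Theory.
Import numFieldNormedType.Exports.

Set Implicit Arguments.
Unset Strict Implicit.
Unset Printing Implicit Defensive.

Local Open Scope classical_set_scope.
Local Open Scope ring_scope.

(* The norm `|_| of 'rV[R]_d is the sup norm: it induces the usual topology,
   but lengths, distances and diameters are measured with [enorm]. *)
Definition dotv (R : realType) (d : nat) (u v : 'rV[R]_d) : R :=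
  \sum_(i < d) u ord0 i * v ord0 i.

Definition enorm (R : realType) (d : nat) (u : 'rV[R]_d) : R :=
  Num.sqrt (dotv u u).

Definition edist (R : realType) (d : nat) (x : 'rV[R]_d) (A : set 'rV[R]_d) : R :=
  inf [set enorm (x - y) | y in A].

Definition ediam (R : realType) (d : nat) (A : set 'rV[R]_d) : R :=
  sup [set enorm (x - y) | x in A & y in A].

(* R^d with its Borel sigma-algebra. *)
Notation borel_rV R d := (g_sigma_algebraType (@open 'rV[R]_d)).

Definition supp (R : realType) (d : nat)
    (mu : {finite_measure set (borel_rV R d) -> \bar R}) : set 'rV[R]_d :=
  [set x | forall U : set 'rV[R]_d, open U -> U x -> (0 < mu U)%E].

Definition posCompactMeasure (R : realType) (d : nat)
    (mu : {finite_measure set (borel_rV R d) -> \bar R}) : Prop :=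
  (0 < mu setT)%E /\ compact (supp mu).

(* A curve [0, a] -> R^d is a pair of a real a >= 0 and a total function
   g : R -> 'rV[R]_d of which only the values on [0, a] are used.  Being
   Lipschitz does not depend on the choice of a norm on R^d. *)
Definition isCurve (R : realType) (d : nat) (a : R) (g : R -> 'rV[R]_d) : Prop :=
  [/\ 0 <= a,
      [lipschitz g t | t in `[0, a]] &
      {ae (@lebesgue_measure R), forall t, `]0, a[%classic t ->
         derivable g t 1 /\ enorm (derive1 g t) <= 1}].

Definition arcLengthParam (R : realType) (d : nat) (a : R) (g : R -> 'rV[R]_d) : Prop :=
  {ae (@lebesgue_measure R), forall t, `]0, a[%classic t ->
     derivable g t 1 /\ enorm (derive1 g t) = 1}.

(* The Euclidean, vector-valued analogue of [variation] and
   [total_variation]. *)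
Definition evariation (R : realType) (d : nat) (a b : R) (g : R -> 'rV[R]_d)
    (s : seq R) : R :=
  let G := g \o nth b (a :: s) in
  \sum_(0 <= n < size s) enorm (G n.+1 - G n).

Definition curveLength (R : realType) (d : nat) (a : R) (g : R -> 'rV[R]_d) : \bar R :=
  ereal_sup [set (evariation 0 a g s)%:E | s in itv_partition 0 a].

Definition energy (R : realType) (d : nat)
    (mu : {finite_measure set (borel_rV R d) -> \bar R}) (lambda p : R)
    (a : R) (g : R -> 'rV[R]_d) : \bar R :=
  (\int[mu]_x ((edist x (g @` `[0, a])) `^ p)%:E + lambda%:E * curveLength a g)%E.

Definition isMinimizer (R : realType) (d : nat)
    (mu : {finite_measure set (borel_rV R d) -> \bar R}) (lambda p : R)
    (a : R) (g : R -> 'rV[R]_d) : Prop :=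
  isCurve a g /\
  energy mu lambda p a g =
    ereal_inf [set energy mu lambda p c.1 c.2 | c in [set c | isCurve c.1 c.2]].

Definition C1c (R : realType) (d : nat) (a b : R) (phi : R -> 'rV[R]_d) : Prop :=
  [/\ forall t, derivable phi t 1,
      continuous (derive1 phi) &
      exists K : set R, [/\ compact K, K `<=` `]a, b[ &
        forall t, ~ K t -> phi t = 0]].

(* Total variation of the distributional derivative of f on ]0, a[; it does
   not change when f is modified on a null set. *)
Definition bvVariation (R : realType) (d : nat) (a : R) (f : R -> 'rV[R]_d) : \bar R :=
  ereal_sup [set (\int[@lebesgue_measure R]_(t in `]0%R, a[)
                    (dotv (f t) (derive1 phi t))%:E)%E
            | phi in [set phi | C1c 0 a phi /\ forall t, enorm (phi t) <= 1]].

Definition isBV (R : realType) (d : nat) (a : R) (f : R -> 'rV[R]_d) : Prop :=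
  (forall i, (@lebesgue_measure R).-integrable `]0, a[
     (fun t => (f t ord0 i)%:E)) /\
  (bvVariation a f < +oo)%E.

(* Main.v *)
(* The proof is a first variation argument. For a test field phi with
   |phi| <= 1, compare gamma with gamma - e phi, run at speed 1 / (1 + e M) where
   M bounds |phi'|.  To first order in e the length drops by e times the integral
   of gamma' . phi', and every distance to the curve grows by at most e.

   To bound the growth of the fidelity term by m ((D + e)^p - D^p), with
   D = diam (supp mu) and m the total mass, one need not know that gamma lies in
   the convex hull of the support: comparing gamma with a constant curve at a
   point of the support gives fidelity(gamma) <= m D^p, and convexity of r^p gives
   (r + e)^p <= ((D + e) / D)^(p-1) r^p + (D + e)^(p-1) e, which is then
   integrated.  Dividing by e and letting e tend to 0 bounds the integral of
   gamma' . phi'.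

   The length of a Lipschitz curve g is related to the integral of |g'| through
   Riemann sums of difference quotients on uniform grids, by dominated
   convergence; the same argument gives the fundamental theorem of calculus. *)
Require Import Defs.
From mathcomp Require Import all_boot all_order all_algebra.
From mathcomp Require Import all_classical all_reals all_analysis.
From mathcomp Require Import measurable_realfun ring lra.
Import Order.TTheory GRing.Theory Num.Theory.
Import numFieldNormedType.Exports.

Local Open Scope classical_set_scope.
Local Open Scope ring_scope.

(** * Euclidean norm *)

Section euclidean_norm.
Context {R : realType} {d : nat}.
Implicit Types u v w : 'rV[R]_d.

Lemma dotvC u v : dotv u v = dotv v u.
Proof. by apply: eq_bigr => i _; rewrite mulrC. Qed.

Lemma dotvDr u v w : dotv u (v + w) = dotv u v + dotv u w.
Proof.
by rewrite /dotv -big_split/=; apply: eq_bigr => i _; rewrite mxE mulrDr.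
Qed.

Lemma dotvZr (c : R) u v : dotv u (c *: v) = c * dotv u v.
Proof. by rewrite /dotv mulr_sumr; apply: eq_bigr => i _; rewrite mxE mulrCA. Qed.

Lemma dotvNr u v : dotv u (- v) = - dotv u v.
Proof. by rewrite -scaleN1r dotvZr mulN1r. Qed.

Lemma dotvBr u v w : dotv u (v - w) = dotv u v - dotv u w.
Proof. by rewrite dotvDr dotvNr. Qed.

Lemma dotvDl u v w : dotv (v + w) u = dotv v u + dotv w u.
Proof. by rewrite dotvC dotvDr !(dotvC u). Qed.

Lemma dotvBl u v w : dotv (v - w) u = dotv v u - dotv w u.
Proof. by rewrite dotvC dotvBr !(dotvC u). Qed.

Lemma dotvZl (c : R) u v : dotv (c *: v) u = c * dotv v u.
Proof. by rewrite dotvC dotvZr dotvC. Qed.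

Lemma dotvv_ge0 u : 0 <= dotv u u.
Proof. by apply: sumr_ge0 => i _; rewrite -expr2 sqr_ge0. Qed.

Lemma enorm_ge0 u : 0 <= enorm u.
Proof. exact: sqrtr_ge0. Qed.

Lemma sqr_enorm u : enorm u ^+ 2 = dotv u u.
Proof. by rewrite sqr_sqrtr ?dotvv_ge0. Qed.

(** Cauchy-Schwarz: the square of [dotv v v *: u - dotv u v *: v] is nonnegative and equals
    [dotv v v] times the difference of the two sides. The factor must be positive, so v = 0 comes
    first. *)
Lemma sqr_dotv_le u v : dotv u v ^+ 2 <= dotv u u * dotv v v.
Proof.
have := dotvv_ge0 v; rewrite le_eqVlt => /predU1P[v0|v_gt0].
  suff -> : dotv u v = 0 by rewrite -v0 mulr0 expr0n.
  move/esym/eqP : v0; rewrite psumr_eq0 => [/allP v0|i _]; last exact: sqr_ge0.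
  apply: big1 => i _; have := v0 i (mem_index_enum i).
  by rewrite mulf_eq0 orbb => /eqP ->; rewrite mulr0.
have := dotvv_ge0 (dotv v v *: u - dotv u v *: v).
rewrite !(dotvBr, dotvBl, dotvZl, dotvZr) (dotvC v u).
set a := dotv u u; set b := dotv v v in v_gt0 *; set c := dotv u v.
rewrite [leRHS](_ : _ = b * (a * b - c ^+ 2)); last by ring.
by rewrite pmulr_rge0// subr_ge0.
Qed.

Lemma dotv_le u v : dotv u v <= enorm u * enorm v.
Proof.
rewrite (le_trans (ler_norm _))// -(@ler_pXn2r _ 2)//.
- by rewrite exprMn !sqr_enorm real_normK ?num_real// sqr_dotv_le.
- by rewrite nnegrE mulr_ge0 ?enorm_ge0.
Qed.

Lemma ler_enormD u v : enorm (u + v) <= enorm u + enorm v.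
Proof.
rewrite -(@ler_pXn2r _ 2)// ?nnegrE ?addr_ge0 ?enorm_ge0//.
rewrite sqrrD !sqr_enorm dotvDl !dotvDr (dotvC v u).
by have := dotv_le u v; lra.
Qed.

Lemma enormZ (c : R) u : enorm (c *: u) = `|c| * enorm u.
Proof.
by rewrite /enorm dotvZl dotvZr mulrA -expr2 sqrtrM ?sqr_ge0// sqrtr_sqr.
Qed.

Lemma enormN u : enorm (- u) = enorm u.
Proof. by rewrite -scaleN1r enormZ normrN1 mul1r. Qed.

Lemma enormB u v : enorm (u - v) = enorm (v - u).
Proof. by rewrite -enormN opprB. Qed.

Lemma ler_enorm_tri u v w : enorm (u - w) <= enorm (u - v) + enorm (v - w).
Proof. by rewrite (le_trans _ (ler_enormD _ _))// subrKA. Qed.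

Lemma coord_le_norm u i : `|u ord0 i| <= `|u|.
Proof.
by rewrite [leRHS]/Num.Def.normr/= mx_normrE (le_bigmax _ _ (ord0, i)).
Qed.

(** With [norm_le_enorm] this allows Lipschitz bounds in the sup norm next to Euclidean lengths. The
    factor is d because a sum of d squares is used and d <= d^2. *)
Lemma enorm_le_norm u : enorm u <= d%:R * `|u|.
Proof.
rewrite -(@ler_pXn2r _ 2)// ?nnegrE ?mulr_ge0 ?enorm_ge0// sqr_enorm.
apply: (@le_trans _ _ (\sum_(i < d) `|u| ^+ 2)).
  apply: ler_sum => i _; rewrite -expr2 -real_normK ?num_real//.
  by rewrite lerXn2r ?nnegrE ?coord_le_norm.
rewrite sumr_const card_ord exprMn -[leLHS]mulr_natl ler_wpM2r ?sqr_ge0//.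
by rewrite -natrX ler_nat expnS expn1; case: d => // n; rewrite leq_pmulr.
Qed.

Lemma norm_le_enorm u : `|u| <= enorm u.
Proof.
rewrite [leLHS]/Num.Def.normr/= mx_normrE; apply/bigmax_leP; split.
  exact: enorm_ge0.
move=> [i j] _ /=; rewrite ord1.
rewrite -(@ler_pXn2r _ 2)// ?nnegrE ?enorm_ge0// sqr_enorm real_normK ?num_real//.
by rewrite /dotv (bigD1 j)//= -expr2 lerDl sumr_ge0// => k _; rewrite -expr2 sqr_ge0.
Qed.

Lemma dotv2_continuous {T : topologicalType} (f g : T -> 'rV[R]_d) :
  continuous f -> continuous g -> continuous (fun x => dotv (f x) (g x)).
Proof.
move=> fc gc; rewrite /dotv; apply: continuous_big => [|i _ x].
  exact: add_continuous.
by apply: cvgM;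
   [apply: (@continuous_comp _ _ _ f (fun v : 'rV[R]_d => v ord0 i) x (fc x))
   |apply: (@continuous_comp _ _ _ g (fun v : 'rV[R]_d => v ord0 i) x (gc x))];
   exact: coord_continuous.
Qed.

Lemma dotv_continuous u : continuous (dotv u).
Proof.
by apply: (@dotv2_continuous _ (fun=> u) id) => // x; [exact: cst_continuous|exact: cvg_id].
Qed.

Lemma enorm_continuous : continuous (@enorm R d).
Proof.
move=> v; apply: (@continuous_comp _ _ _ (fun v => dotv v v) (@Num.sqrt R)).
  by apply: (@dotv2_continuous _ id id) => y; exact: cvg_id.
exact: sqrt_continuous.
Qed.

Lemma norm_dotv_le u v : `|dotv u v| <= enorm u * enorm v.
Proof.
rewrite ler_norml dotv_le andbT lerNl -dotvNr.
by rewrite (le_trans (dotv_le _ _))// enormN.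
Qed.

End euclidean_norm.

(** * Differentiability of continuous curves *)

Section derivability_set.
Context {R : realType} {d : nat}.
Variable g : R -> 'rV[R]_d.

(** The quotient inside [derivable] in direction 1, with [h%:A] simplified to h. *)
Definition diff_quot (h t : R) : 'rV[R]_d := h^-1 *: (g (h + t) - g t).

Lemma derivableE t : derivable g t 1 = cvg (diff_quot ^~ t @ 0^').
Proof.
rewrite /derivable; set q := (fun h => _).
by rewrite (_ : q = diff_quot ^~ t)//; apply/funext => h; rewrite /q/= [h%:A]mulr1.
Qed.

(** Completeness turns existence of the limit into a Cauchy condition whose precision n and radius m
    range over countable sets, as measurability requires. *)
Lemma derivable_cauchyP t : derivable g t 1 <->
  forall n : nat, exists m : nat, forall h k : R, h != 0 -> k != 0 ->
    `|h| < m.+1%:R^-1 -> `|k| < m.+1%:R^-1 ->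
    `|diff_quot h t - diff_quot k t| <= n.+1%:R^-1.
Proof.
rewrite derivableE; split=> [/cvg_ex[l /cvgrPdist_le gl] n|gC].
  have n0 : 0 < n.+1%:R^-1 / 2 :> R by rewrite divr_gt0.
  have [e /= e0 el] := gl _ n0.
  have [m me] : exists m : nat, m.+1%:R^-1 < e.
    by have [m _ /(_ m (leqnn m)) me] := near_infty_natSinv_lt (PosNum e0); exists m.
  exists m => h k h0 k0 hm km.
  rewrite -(subrKA l) (le_trans (ler_normD _ _))// (splitr n.+1%:R^-1) lerD//.
    rewrite distrC; apply: el => //=.
    by rewrite sub0r normrN (lt_trans hm).
  apply: el => //=.
  by rewrite sub0r normrN (lt_trans km).
apply/cauchy_cvgP/cauchy_exP => e e0.
have [n _ /(_ n (leqnn n)) /= ne] := near_infty_natSinv_lt (PosNum e0).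
have [m gm] := gC n.
have m0 : (0 : R) < m.+1%:R^-1 / 2 by rewrite divr_gt0.
exists (diff_quot (m.+1%:R^-1 / 2) t).
exists m.+1%:R^-1 => /=; first by rewrite invr_gt0.
move=> k /= + k0; rewrite sub0r normrN => km.
rewrite -ball_normE /= (le_lt_trans _ ne)//; apply: gm => //.
rewrite gtr0_norm//; by rewrite ltr_pdivrMr// ltr_pMr// ltrDl.
Qed.

Hypothesis gc : continuous g.

Lemma diff_quot_continuous h : continuous (diff_quot h).
Proof.
move=> t; apply: cvgZl_tmp; apply: cvgB; last exact: gc.
apply: (@continuous_comp _ _ _ (fun t => h + t) g); last exact: gc.
by apply: cvgD; [exact: cvg_cst|exact: cvg_id].
Qed.

(** For fixed n and m the condition on all h and k is an intersection of closed sets, as quotients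
    are continuous in t; it is closed although the family is uncountable. *)
Lemma measurable_derivable : measurable [set t | derivable g t 1].
Proof.
rewrite (_ : [set _ | _] = \bigcap_n \bigcup_m
    \bigcap_(hk in [set hk : R * R | [/\ hk.1 != 0, hk.2 != 0,
       `|hk.1| < m.+1%:R^-1 & `|hk.2| < m.+1%:R^-1]])
    [set t | `|diff_quot hk.1 t - diff_quot hk.2 t| <= n.+1%:R^-1]).
  apply: bigcap_measurable => // n _; apply: bigcup_measurable => m _.
  apply: closed_measurable; apply: closed_bigI => -[h k] _ /=.
  apply: (@closed_comp _ _ (fun t => `|diff_quot h t - diff_quot k t|)
    [set x | x <= n.+1%:R^-1]); last exact: closed_le.
  move=> t _; apply: cvg_norm.
  by apply: cvgB; exact: diff_quot_continuous.
apply/seteqP; split=> t /=.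
  move/derivable_cauchyP => tD n _; have [m gm] := tD n.
  by exists m => // -[h k] /= [*]; exact: gm.
move=> tD; apply/derivable_cauchyP => n; have [m _ gm] := tD n I.
by exists m => h k *; apply: (gm (h, k)).
Qed.

(* Where g is not differentiable, [derive1 g] is the constant junk value [point]. *)
Lemma measurable_derive1_comp (Phi : 'rV[R]_d -> R) : continuous Phi ->
  measurable_fun setT (Phi \o derive1 g).
Proof.
move=> Phic; rewrite -(setUv [set t | derivable g t 1]).
have mD := measurable_derivable.
apply/measurable_funU => //; [exact: measurableC|split].
- apply: (@measurable_fun_cvg _ _ _ _ (fun n => Phi \o diff_quot n.+1%:R^-1)).
  + move=> n; apply: measurable_funTS; apply: continuous_measurable_fun => t.
    by apply: continuous_comp; [exact: diff_quot_continuous|exact: Phic].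
  + move=> t /=; rewrite derivableE => tD.
    apply: (@cvg_comp _ _ _ _ Phi); last exact: Phic.
    apply: (@cvg_comp _ _ _ (fun n : nat => n.+1%:R^-1) (diff_quot ^~ t) _ _ _ _ tD).
    move=> A [e /= e0 eA]; have := near_infty_natSinv_lt (PosNum e0).
    apply: filterS => n /= ne; apply: eA; last by rewrite gt_eqF.
    by rewrite /= sub0r normrN gtr0_norm.
- apply: (@eq_measurable_fun _ _ _ _ _ (cst (Phi point))); last exact: measurable_cst.
  move=> t; rewrite inE /= derivableE => tD.
  by rewrite /derive1 dvgP.
Qed.

End derivability_set.

(** * Riemann sums of difference quotients *)

(** The point t need not be an endpoint: the first-order errors at v and u are at most e (v - t) and
    e (t - u), which add up to e (v - u). *)
Lemma straddle_slope {R : realType} {d : nat} (g : R -> 'rV[R]_d) (t : R) :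
  derivable g t 1 -> forall e, 0 < e -> exists2 r, 0 < r &
  forall u v, u <= t <= v -> u < v -> v - u < r ->
  `|(v - u)^-1 *: (g v - g u) - derive1 g t| <= e.
Proof.
rewrite derivableE => gt e e0.
have /cvgrPdist_le /(_ e e0)[r /= r0 gr] : diff_quot g ^~ t @ 0^' --> derive1 g t.
  exact: gt.
(* Stated without division, so that h = 0, that is u = t or v = t, is included. *)
have key h : `|h| < r -> `|g (h + t) - g t - h *: derive1 g t| <= e * `|h|.
  move=> hr; have [->|h0] := eqVneq h 0.
    by rewrite add0r scale0r !subrr !normr0 mulr0.
  have := gr h; rewrite /= sub0r normrN => /(_ hr h0).
  rewrite distrC -(ler_pM2r (_ : 0 < `|h|)) ?normr_gt0// mulrC -normrZ.
  by rewrite /diff_quot scalerBr scalerA divff// scale1r.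
exists r => // u v /andP[ut tv] uv uvr.
have vu0 : 0 < v - u by rewrite subr_gt0.
rewrite -[derive1 g t](scalerK (lt0r_neq0 vu0)) -scalerBr normrZ gtr0_norm ?invr_gt0//.
rewrite mulrC ler_pdivrMr//.
have -> : g v - g u - (v - u) *: derive1 g t =
    (g ((v - t) + t) - g t - (v - t) *: derive1 g t) -
    (g ((u - t) + t) - g t - (u - t) *: derive1 g t).
  by rewrite !subrK; apply/rowP => i; rewrite !mxE; ring.
have vt : `|v - t| = v - t by rewrite ger0_norm ?subr_ge0.
have tu : `|u - t| = t - u by rewrite ler0_norm ?subr_le0// opprB.
rewrite (le_trans (ler_normB _ _))// (_ : e * (v - u) = e * `|v - t| + e * `|u - t|).
  by rewrite lerD// key// ?vt ?tu; lra.
by rewrite vt tu; ring.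
Qed.

Section uniform_step.
Context {R : realType}.
Variables (a b : R).
Hypothesis ab : a < b.

Definition mesh (n : nat) : R := (b - a) / n.+1%:R.
Definition grid (n i : nat) : R := a + i%:R * mesh n.

Lemma mesh_gt0 n : 0 < mesh n.
Proof. by rewrite divr_gt0// subr_gt0. Qed.

Lemma grid0 n : grid n 0 = a.
Proof. by rewrite /grid mul0r addr0. Qed.

Lemma gridS n i : grid n i.+1 = grid n i + mesh n.
Proof. by rewrite /grid -natr1 mulrDl mul1r addrA. Qed.

Lemma gridn n : grid n n.+1 = b.
Proof. by rewrite /grid /mesh mulrC divfK// addrC subrK. Qed.

Lemma ler_grid n i j : (i <= j)%N -> grid n i <= grid n j.
Proof. by move=> ij; rewrite lerD2l ler_pM2r ?mesh_gt0// ler_nat. Qed.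

Lemma cvg_mesh : mesh @ \oo --> 0.
Proof.
rewrite -(mulr0 (b - a)); apply: cvgMl_tmp; exact: cvg_harmonic.
Qed.

Definition step (n : nat) (c : nat -> R) (t : R) : R :=
  \sum_(i < n.+1) c i * \1_`[grid n i, grid n i.+1[%classic t.

(** The index is the integer part of (t - a) / [mesh n]; the cells are half-open, so all other terms
    vanish. *)
Lemma step_eval n c t : a < t < b -> exists j,
  [/\ (j < n.+1)%N, grid n j <= t < grid n j.+1 & step n c t = c j].
Proof.
move=> /andP[at_ tb]; have m0 := mesh_gt0 n.
have ta0 : 0 <= (t - a) / mesh n by rewrite divr_ge0 ?subr_ge0 ?ltW.
have /andP[jl ju] := Num.Theory.truncn_itv ta0.
set j := Num.truncn _ in jl ju.
rewrite ler_pdivlMr// in jl; rewrite ltr_pdivrMr// in ju.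
have jt : grid n j <= t < grid n j.+1 by rewrite /grid; lra.
have jn : (j < n.+1)%N.
  rewrite ltnNge; apply/negP => /(ler_grid n); rewrite gridn => bj.
  by move: jt; rewrite (lt_geF (lt_le_trans tb bj)).
exists j; split => //; rewrite /step (bigD1 (Ordinal jn))//= indicE mem_set/= ?in_itv//.
rewrite mulr1 big1 ?addr0// => i ij; rewrite indicE memNset ?mulr0//= in_itv/=.
move: ij; rewrite -val_eqE/= neq_ltn => /orP[ij|ij].
  by move/andP => [_]; rewrite ltNge (le_trans (ler_grid n _ _ ij))//; case/andP: jt.
move/andP => [ti _]; case/andP: jt => _; apply/negP; rewrite -leNgt.
by rewrite (le_trans (ler_grid n _ _ ij)).
Qed.

Lemma measurable_step n c (D : set R) : measurable_fun D (step n c).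
Proof.
apply: measurable_sum => i; apply: measurable_funM; first exact: measurable_cst.
exact: measurable_indic.
Qed.

Lemma integral_step n c : (\int[@lebesgue_measure R]_(t in `]a, b[) (step n c t)%:E =
  (\sum_(i < n.+1) c i * mesh n)%:E)%E.
Proof.
(* The first cell contains a; adding this null point to the domain makes every cell a subset of
   it. *)
rewrite integral_itv_obnd_cbnd; last first.
  by apply/measurable_EFinP; exact: measurable_step.
under eq_integral => t _ do rewrite -sumEFin.
have int i : (@lebesgue_measure R).-integrable `[a, b[
     (fun t : R => (c i * \1_`[grid n i, grid n i.+1[%classic t)%:E).
  have -> : (fun t : R => (c i * \1_`[grid n i, grid n i.+1[%classic t)%:E) =
    (fun t : R => ((c i)%:E * (\1_`[grid n i, grid n i.+1[%classic t)%:E)%E).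
    by [].
  apply: integrableZl => //.
  exact: (integrableS measurableT _ _ (integrable_indic_itv _ _ _ _)).
rewrite integral_sum// -sumEFin; apply: eq_bigr => i _.
under eq_integral => t _ do rewrite EFinM.
rewrite integralZl//; last first.
  exact: (integrableS measurableT _ _ (integrable_indic_itv _ _ _ _)).
rewrite integral_indic// setIidl; last first.
  apply: subset_itv; rewrite bnd_simp.
    by rewrite -(grid0 n) ler_grid.
  by rewrite -(gridn n) ler_grid.
rewrite /= lebesgue_measure_itv/= lte_fin gridS ltrDl mesh_gt0.
by rewrite -EFinB addrC addKr EFinM.
Qed.

End uniform_step.

Lemma ae_lebesgueS {R : realType} (P Q : R -> Prop) : (forall t, P t -> Q t) ->
  {ae (@lebesgue_measure R), forall t, P t} ->
  {ae (@lebesgue_measure R), forall t, Q t}.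
Proof. exact: (@filterS _ _ (ae_filter_ringOfSetsType (@lebesgue_measure R))). Qed.

(** Off the null set where the bound may fail, f is bounded and measurable on a set of finite
    measure. *)
Lemma itv_ae_bounded_integrable {R : realType} (M a b : R) (f : R -> R) :
  measurable_fun `]a, b[ f ->
  {ae (@lebesgue_measure R), forall t, `]a, b[%classic t -> `|f t| <= M} ->
  (@lebesgue_measure R).-integrable `]a, b[ (EFin \o f).
Proof.
move=> mf [N [mN N0 fM]].
apply/(negligible_integrable mN) => //; first exact/measurable_EFinP.
have mD : measurable (`]a, b[ `\` N) by exact: measurableD.
apply: measurable_bounded_integrable => //.
- apply: (@le_lt_trans _ _ (lebesgue_measure (`]a, b[%classic : set R))).
    by apply: le_measure; rewrite ?inE//; exact: subIsetl.
  by rewrite /= lebesgue_measure_itv/=; case: ifPn => // _; rewrite -EFinB ltry.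
- exact: measurable_funS mf.
- exists M; split; rewrite ?num_real// => A MA t [tab Nt] /=.
  rewrite (le_trans _ (ltW MA))// leNgt; apply: contra_notN Nt => Mf.
  by apply: fM => /(_ tab); rewrite leNgt Mf.
Qed.

Section lipschitz_curve.
Context {R : realType} {d : nat}.
Variables (g : R -> 'rV[R]_d) (K : R).
Hypothesis gK : forall s t, `|g s - g t| <= K * `|s - t|.

Lemma lipschitz_fun_continuous : continuous g.
Proof.
move=> t; apply/cvgrPdist_lt => e e0.
have K0 : 0 <= K.
  by have := le_trans (normr_ge0 _) (gK 1 0); rewrite subr0 normr1 mulr1.
exists (e / (K + 1)) => [|s /= ts]; first by rewrite /= divr_gt0// ltr_wpDl.
rewrite (le_lt_trans (gK t s))//.
move: ts; rewrite ltr_pdivlMr ?ltr_wpDl// => ts.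
by rewrite (le_lt_trans _ ts)// mulrC ler_wpM2l// lerDl.
Qed.

Lemma norm_slope_le u v : u < v -> `|(v - u)^-1 *: (g v - g u)| <= K.
Proof.
move=> uv; rewrite normrZ gtr0_norm ?invr_gt0 ?subr_gt0//.
rewrite mulrC ler_pdivrMr ?subr_gt0// (le_trans (gK _ _))//.
by rewrite gtr0_norm ?subr_gt0.
Qed.

Variables (a b C : R) (Phi : 'rV[R]_d -> R).
Hypothesis ab : a < b.
Hypothesis g_diff : {ae (@lebesgue_measure R), forall t, `]a, b[%classic t -> derivable g t 1}.
Hypothesis Phic : continuous Phi.
Hypothesis PhiC : forall v, `|Phi v| <= C * `|v|.
Let x := grid a b.
Let slope n i := (mesh a b n)^-1 *: (g (x n i.+1) - g (x n i)).

(* The sums are integrals of step functions which converge to [Phi (g' t)] at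
   every point t of differentiability, boundedly since g is Lipschitz. *)
Lemma riemann_sum_derive1 :
  (@lebesgue_measure R).-integrable `]a, b[ (EFin \o (Phi \o derive1 g)) /\
  (\sum_(i < n.+1) Phi (slope n i) * mesh a b n)%:E @[n --> \oo] -->
    (\int[@lebesgue_measure R]_(t in `]a, b[) (Phi (derive1 g t))%:E)%E.
Proof.
have slopeE n i : slope n i = (x n i.+1 - x n i)^-1 *: (g (x n i.+1) - g (x n i)).
  by rewrite /slope; congr (_^-1 *: _); rewrite /x gridS addrC addKr.
have xS n i : x n i < x n i.+1 by rewrite /x gridS ltrDl mesh_gt0.
have C0 : 0 <= `|C| by [].
(* The dominating function is the constant [|C| * K], since all slopes have norm at most K. *)
have [| | | | |h1 _ h2] := @dominated_convergence _ _ _ (@lebesgue_measure R)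
  `]a, b[ (measurable_itv _)
  (fun n t => (step a b n (fun i => Phi (slope n i)) t)%:E)
  (EFin \o (Phi \o derive1 g)) (cst (`|C| * K)%:E).
- by move=> n; apply/measurable_EFinP; exact: measurable_step.
- apply/measurable_EFinP; apply: measurable_funTS.
  by apply: measurable_derive1_comp => //; exact: lipschitz_fun_continuous.
- apply: ae_lebesgueS g_diff => t gt tab.
  have {}gt := gt tab; apply: cvg_EFin; first exact: nearW.
  (* For each n, j n is the cell containing t; at t the step function is then [Phi] of the slope
     over a cell that shrinks to t. *)
  have /choice[j jP] n : exists j, x n j <= t < x n j.+1 /\
      step a b n (fun i => Phi (slope n i)) t = Phi (slope n j).
    have [j [_ ? ?]] := @step_eval R a b ab n (fun i => Phi (slope n i)) t tab.
    by exists j.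
  rewrite (_ : fine \o _ = Phi \o (fun n => slope n (j n))); last first.
    by apply/funext => n /=; have [_ ->] := jP n.
  apply: (@cvg_comp _ _ _ _ Phi); last exact: Phic.
  apply/cvgrPdist_le => e e0.
  have [r r0 gr] := @straddle_slope R d g t gt e e0.
  have /cvgrPdist_lt /(_ r r0) := @cvg_mesh R a b.
  apply: filterS => n; rewrite sub0r normrN gtr0_norm ?mesh_gt0// => mr.
  rewrite distrC slopeE gr//.
    by have [/andP[-> /ltW->]] := jP n.
  by rewrite /x gridS addrC addKr.
- by apply: (itv_ae_bounded_integrable (`|(`|C| * K)|)) => //; exact: aeW.
- apply: aeW => t n tab /=.
  have [j [_ _ ->]] := @step_eval R a b ab n (fun i => Phi (slope n i)) t tab.
  rewrite lee_fin (le_trans (PhiC _))// slopeE.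
  rewrite (le_trans (ler_wpM2r _ (ler_norm C)))// ler_wpM2l//.
  exact: norm_slope_le.
split => //.
apply: cvg_trans h2; apply: near_eq_cvg; apply: nearW => n /=.
by rewrite integral_step.
Qed.

End lipschitz_curve.

(** * Variation along partitions *)

Section evariation.
Context {R : realType} {d : nat}.
Implicit Types (g : R -> 'rV[R]_d) (s : seq R).

Lemma evariation_nil a b g : evariation a b g [::] = 0.
Proof. by rewrite /evariation big_nil. Qed.

Lemma evariation_cons a b g x s :
  evariation a b g (x :: s) = enorm (g x - g a) + evariation x b g s.
Proof. by rewrite /evariation/= big_nat_recl. Qed.

(** The function k is a control function: the bounds on the chords telescope along the partition. *)
Lemma evariation_le_increment (k : R -> R) a b g s : itv_partition a b s ->
  (forall x y, a <= x -> x < y -> y <= b -> enorm (g y - g x) <= k y - k x) ->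
  evariation a b g s <= k b - k a.
Proof.
elim: s a => [a /itv_partition_nil ->|x s ih a abs gk].
  by rewrite evariation_nil subrr.
have xb := itv_partition_le (itv_partition_cons abs).
have ax : a < x by case: abs => /= /andP[].
rewrite evariation_cons.
have -> : k b - k a = (k x - k a) + (k b - k x) by ring.
rewrite lerD ?gk//; apply: ih (itv_partition_cons abs) _ => y z xy.
by apply: gk; rewrite (le_trans (ltW ax)).
Qed.

Lemma eq_evariation a b g g' s : itv_partition a b s ->
  (forall t, a <= t <= b -> g t = g' t) -> evariation a b g s = evariation a b g' s.
Proof.
elim: s a => [a _ _|x s ih a abs gg']; first by rewrite !evariation_nil.
have xb := itv_partition_le (itv_partition_cons abs).
have ax : a < x by case: abs => /= /andP[].
rewrite !evariation_cons !gg' ?(ltW ax) ?lexx ?(le_trans (ltW ax))//.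
congr (_ + _); apply: ih (itv_partition_cons abs) _ => t /andP[xt tb].
by rewrite gg'// (le_trans (ltW ax)).
Qed.

Lemma curveLength_ge0 a g : 0 <= a -> (0 <= curveLength a g)%E.
Proof.
(* For a = 0 the list [[:: a]] is not strictly increasing from 0, so the empty partition is used. *)
rewrite le_eqVlt => /predU1P[<-|a0].
  apply: ereal_sup_ubound; exists [::]; last by rewrite evariation_nil.
  by split.
apply: (@le_trans _ _ (evariation 0 a g [:: a])%:E).
  by rewrite lee_fin evariation_cons evariation_nil addr0 enorm_ge0.
by apply: ereal_sup_ubound; exists [:: a] => //; exact: itv_partition1.
Qed.

Lemma curveLength_cst a (v : 'rV[R]_d) : (curveLength a (cst v) <= 0)%E.
Proof.
apply: ge_ereal_sup => _ [s abs <-].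
(* The bound 0 is read as an increment of the control function 0. *)
rewrite lee_fin -(subrr (0 : R)) (evariation_le_increment (cst 0) _ _ _ _ abs)// => x y *.
by rewrite /= !subrr /enorm /dotv big1 ?sqrtr0// => i _; rewrite mxE mul0r.
Qed.

Lemma evariation_grid a b g n : a < b ->
  itv_partition a b [seq grid a b n i.+1 | i <- iota 0 n.+1] /\
  evariation a b g [seq grid a b n i.+1 | i <- iota 0 n.+1] =
    \sum_(i < n.+1) enorm (g (grid a b n i.+1) - g (grid a b n i)).
Proof.
move=> ab; set s := [seq _ | _ <- _].
have sE i : (i <= n.+1)%N -> nth b (a :: s) i = grid a b n i.
  case: i => [|i] ni /=; first by rewrite grid0.
  by rewrite (nth_map 0%N) ?size_iota// nth_iota.
split; last first.
  rewrite /evariation /s size_map size_iota big_mkord; apply: eq_bigr => i _.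
  congr (enorm (g _ - g _)); first exact: (sE i.+1 (ltn_ord i)).
  exact: (sE i (ltnW (ltn_ord i))).
have sn : size s = n.+1 by rewrite size_map size_iota.
split; last by rewrite -(gridn a b n) -sE// -sn (last_nth b).
apply/(pathP b) => i; rewrite sn => ni.
rewrite (sE i (ltnW ni)) (sE i.+1 ni : nth b s i = _).
by rewrite gridS ltrDl mesh_gt0.
Qed.

End evariation.

Section lipschitz_curve_integrals.
Context {R : realType} {d : nat}.
Variables (g : R -> 'rV[R]_d) (K a b : R).
Hypothesis gK : forall s t, `|g s - g t| <= K * `|s - t|.
Hypothesis ab : a < b.
Hypothesis g_diff : {ae (@lebesgue_measure R), forall t, `]a, b[%classic t -> derivable g t 1}.

(** The fundamental theorem of calculus in direction u: for a linear [Phi] the Riemann sums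
    telescope, so all equal their limit. *)
Lemma lipschitz_dotv_integral (u : 'rV[R]_d) :
  (@lebesgue_measure R).-integrable `]a, b[ (EFin \o (dotv u \o derive1 g)) /\
  dotv u (g b - g a) = \int[@lebesgue_measure R]_(t in `]a, b[) dotv u (derive1 g t).
Proof.
have uC (v : 'rV[R]_d) : `|dotv u v| <= enorm u * d%:R * `|v|.
  by rewrite (le_trans (norm_dotv_le _ _))// -mulrA ler_wpM2l ?enorm_ge0// enorm_le_norm.
have [int cv] := riemann_sum_derive1 g K gK a b _ _ ab g_diff (@dotv_continuous R d u) uC.
split=> //; rewrite /Rintegral -[LHS]/(fine (dotv u (g b - g a))%:E); congr fine.
apply: (cvg_unique _ _ cv) => //.
apply: cvg_near_cst; apply: nearW => n; congr EFin.
have m0 := mesh_gt0 a b ab n.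
transitivity (\sum_(0 <= i < n.+1) (dotv u (g (grid a b n i.+1)) - dotv u (g (grid a b n i)))).
  rewrite big_mkord; apply: eq_bigr => i _.
  by rewrite dotvZr mulrC mulrA divff ?gt_eqF// mul1r dotvBr.
by rewrite telescope_sumr// gridn grid0 dotvBr.
Qed.

(** For [Phi] the Euclidean norm, each Riemann sum is the variation along a uniform grid. *)
Lemma lipschitz_enorm_integral :
  (\int[@lebesgue_measure R]_(t in `]a, b[) (enorm (derive1 g t))%:E <=
   ereal_sup [set (evariation a b g s)%:E | s in itv_partition a b])%E.
Proof.
have eC (v : 'rV[R]_d) : `|enorm v| <= d%:R * `|v|.
  by rewrite ger0_norm ?enorm_ge0// enorm_le_norm.
have [_ cv] := riemann_sum_derive1 g K gK a b d%:R _ ab g_diff (@enorm_continuous R d) eC.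
apply: cvge_le cv; apply: nearW => n.
have [sP sE] := evariation_grid a b g n ab.
apply: ereal_sup_ubound; exists [seq grid a b n i.+1 | i <- iota 0 n.+1] => //.
rewrite sE; congr EFin; apply: eq_bigr => i _.
have m0 := mesh_gt0 a b ab n.
by rewrite enormZ gtr0_norm ?invr_gt0// mulrC mulrA divff ?gt_eqF// mul1r.
Qed.

End lipschitz_curve_integrals.

(** * The perturbed curve *)

Definition perturbed {R : realType} {V : normedModType R} (f g : R -> V) (e t : R) : V :=
  f t - e *: g t.

Lemma perturbed_derive {R : realType} {V : normedModType R} (f g : R -> V) (e t : R) :
  derivable f t 1 -> derivable g t 1 ->
  derivable (perturbed f g e) t 1 /\
  derive1 (perturbed f g e) t = perturbed (derive1 f) (derive1 g) e t.
Proof.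
move=> ft gt; have et : derivable (e \*: g) t 1 by exact: derivableZ.
split; first exact: (derivableB ft et).
by rewrite !derive1E (deriveB ft et) deriveZ// /perturbed !derive1E.
Qed.

Lemma perturbedE {R : realType} {d} (f g : R -> 'rV[R]_d) (e t : R) :
  perturbed f g e t = f t - e *: g t.
Proof. by []. Qed.

(** The difference f2 - f1 agrees almost everywhere with its absolute value, whose integral is
    nonnegative. *)
Lemma ae_le_Rintegral {R : realType} (a b : R) (f1 f2 : R -> R) :
  (@lebesgue_measure R).-integrable `]a, b[ (EFin \o f1) ->
  (@lebesgue_measure R).-integrable `]a, b[ (EFin \o f2) ->
  {ae (@lebesgue_measure R), forall t, `]a, b[%classic t -> f1 t <= f2 t} ->
  \int[@lebesgue_measure R]_(t in `]a, b[) f1 t <=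
  \int[@lebesgue_measure R]_(t in `]a, b[) f2 t.
Proof.
move=> if1 if2 f12; rewrite -subr_ge0 -RintegralB//.
have mf : measurable_fun `]a, b[ (fun t => f2 t - f1 t).
  by apply: measurable_funB; apply/measurable_EFinP; [case/integrableP: if2|case/integrableP: if1].
apply: (@le_trans _ _ (\int[@lebesgue_measure R]_(t in `]a, b[) `|f2 t - f1 t|)).
  exact: Rintegral_ge0.
rewrite le_eqVlt; apply/orP; left; apply/eqP; congr fine.
apply: ae_eq_integral => //.
- by apply/measurable_EFinP; exact: measurableT_comp.
- exact/measurable_EFinP.
- by apply: ae_lebesgueS f12 => t f12 /f12 le12; rewrite ger0_norm ?subr_ge0.
Qed.

(** With z = e^2 M^2 / 2 - e (u . v), the square of the left side is at most 1 + 2 z, and 1 + 2 z <=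
    (1 + z)^2. *)
Lemma enormB_le_linear {R : realType} {d : nat} (u v : 'rV[R]_d) (e M : R) :
  enorm u = 1 -> 0 <= e -> enorm v <= M ->
  enorm (u - e *: v) <= 1 + e ^+ 2 * M ^+ 2 / 2 - e * dotv u v.
Proof.
move=> u1 e0 vM; set x := (X in 1 + X - _); set y := e * _.
have M0 : 0 <= M by rewrite (le_trans (enorm_ge0 v)).
have le2 : enorm (u - e *: v) ^+ 2 <= 1 + 2 * (x - y).
  rewrite sqr_enorm !(dotvBr, dotvBl, dotvZl, dotvZr) (dotvC v u) -!sqr_enorm u1.
  have : enorm v ^+ 2 <= M ^+ 2 by rewrite lerXn2r ?nnegrE ?enorm_ge0.
  move/(ler_wpM2l (sqr_ge0 e)) => ev.
  by rewrite /x /y; lra.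
have := sqr_ge0 (enorm (u - e *: v)); set E := enorm _ in le2 *.
move=> E0; have E1 : 0 <= E by exact: enorm_ge0.
(* Since 1 + 2 (x - y) bounds a square, x - y >= -1/2; hence both sides may be squared. *)
have xy : 0 <= 1 + x - y by lra.
rewrite -(@ler_pXn2r _ 2) ?nnegrE// (le_trans le2)//.
by have := sqr_ge0 (x - y); rewrite !expr2; lra.
Qed.

Section perturbed_curve.
Context {R : realType} {d : nat}.
Variables (g phi : R -> 'rV[R]_d) (K M L e : R).
Hypothesis gK : forall s t, `|g s - g t| <= K * `|s - t|.
Hypothesis g_unit : {ae (@lebesgue_measure R), forall t, `]0, L[%classic t ->
  derivable g t 1 /\ enorm (derive1 g t) = 1}.
Hypothesis phiM : forall s t, `|phi s - phi t| <= M * `|s - t|.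
Hypothesis phi_diff : forall t, derivable phi t 1.
Hypothesis phi_M : forall t, enorm (derive1 phi t) <= M.
Hypothesis phi_C1 : continuous (derive1 phi).
Hypothesis e0 : 0 <= e.

Let f := perturbed g phi e.

Lemma perturbed_lipschitz s t : `|f s - f t| <= (K + e * M) * `|s - t|.
Proof.
have -> : f s - f t = (g s - g t) - e *: (phi s - phi t).
  by rewrite /f !perturbedE; apply/rowP => i; rewrite !mxE; ring.
rewrite (le_trans (ler_normB _ _))// mulrDl lerD//.
by rewrite normrZ ger0_norm// -mulrA ler_wpM2l.
Qed.

Let p t := dotv (derive1 g t) (derive1 phi t).

Lemma measurable_dotv_derive1 : measurable_fun setT p.
Proof.
apply: measurable_sum => i; apply: measurable_funM.
  apply: (measurable_derive1_comp g _ (fun v : 'rV[R]_d => v ord0 i)).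
    exact: lipschitz_fun_continuous gK.
  exact: coord_continuous.
apply: continuous_measurable_fun => t.
apply: (@continuous_comp _ _ _ (derive1 phi) (fun v : 'rV[R]_d => v ord0 i)).
  exact: phi_C1.
exact: coord_continuous.
Qed.

Lemma integrable_dotv_derive1 : (@lebesgue_measure R).-integrable `]0, L[ (EFin \o p).
Proof.
apply: (itv_ae_bounded_integrable M).
  exact: measurable_funTS measurable_dotv_derive1.
apply: ae_lebesgueS g_unit => t gt /gt[_ g1].
by rewrite (le_trans (norm_dotv_le _ _))// g1 mul1r.
Qed.

(** The primitive in [length_bound] runs over ]0, t], which for t = L adds the null point L. *)
Lemma integrable_dotv_derive1_oc t : t <= L ->
  (@lebesgue_measure R).-integrable `]0, t] (EFin \o p).
Proof.
move=> tL; have mL : measurable ([set L] : set (measurableTypeR R)) by exact: measurable_set1.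
apply/(negligible_integrable mL) => //.
- by apply/measurable_EFinP; exact: measurable_funTS measurable_dotv_derive1.
- exact: lebesgue_measure_set1.
- apply: integrableS integrable_dotv_derive1 => //; first exact: measurableD.
  move=> r [/= + /eqP rL]; rewrite !in_itv/= => /andP[-> rt]/=.
  by rewrite lt_neqAle rL (le_trans rt).
Qed.

(** A control function for the length of f: its increments integrate the first-order bound on
    |f'|. *)
Definition length_bound (t : R) : R :=
  (1 + e ^+ 2 * M ^+ 2 / 2) * t - e * \int[@lebesgue_measure R]_(s in `]0, t]) p s.

(** The chord w has length u . w for its direction u. This is the integral of u . f', at most that
    of |f'|, to which [enormB_le_linear] applies. *)
Lemma enorm_perturbed_le s t : 0 <= s -> s < t -> t <= L ->
  enorm (f t - f s) <= length_bound t - length_bound s.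
Proof.
(* If w = 0 then u = 0, because the inverse of 0 is 0; both facts on u below still hold. *)
move=> s0 st tL; set w := f t - f s; pose u := (enorm w)^-1 *: w.
have sub : (`]s, t[ `<=` `]0, L[)%classic by apply: subset_itv; rewrite bnd_simp.
have uw : dotv u w = enorm w.
  rewrite dotvZl -sqr_enorm; have [->|w0] := eqVneq (enorm w) 0.
    by rewrite expr0n mulr0.
  by rewrite expr2 mulKf.
have u1 : enorm u <= 1.
  rewrite enormZ; have [->|w0] := eqVneq (enorm w) 0; first by rewrite mulr0.
  by rewrite ger0_norm ?invr_ge0 ?enorm_ge0// mulVf.
have diff : {ae (@lebesgue_measure R), forall r, `]s, t[%classic r -> derivable f r 1}.
  by apply: ae_lebesgueS g_unit => r gr /sub/gr[] /(perturbed_derive _ phi e)[].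
have [iu dw] := lipschitz_dotv_integral f _ s t perturbed_lipschitz st diff u.
have ip : (@lebesgue_measure R).-integrable `]s, t[ (EFin \o p).
  by apply: integrableS integrable_dotv_derive1.
have ic : (@lebesgue_measure R).-integrable `]s, t[
    (EFin \o cst (1 + e ^+ 2 * M ^+ 2 / 2)).
  apply: (itv_ae_bounded_integrable `|1 + e ^+ 2 * M ^+ 2 / 2|).
    exact: measurable_cst.
  exact: aeW.
have iep : (@lebesgue_measure R).-integrable `]s, t[ (EFin \o (fun r => e * p r)).
  exact: (integrableZl _ e ip).
rewrite -uw dw.
apply: (@le_trans _ _ (\int[@lebesgue_measure R]_(r in `]s, t[)
    (1 + e ^+ 2 * M ^+ 2 / 2 - e * p r))).
  apply: ae_le_Rintegral; [exact: iu|exact: (integrableB _ ic iep)|].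
  apply: ae_lebesgueS g_unit => r gr rst; have [dg g1] := gr (sub r rst).
  have [_ ->] := perturbed_derive g phi e r dg (phi_diff r).
  rewrite perturbedE.
  apply: (le_trans _ (enormB_le_linear _ _ _ _ g1 e0 (phi_M r))).
  rewrite (le_trans (dotv_le _ _))//.
  by rewrite ler_piMl ?enorm_ge0.
rewrite RintegralB// RintegralZl// Rintegral_cst//= lebesgue_measure_itv/= lte_fin st.
(* The integral over ]s, t[ becomes a difference of primitives once the endpoint t is added. *)
have itB := @Rintegral_itvB R p (BRight 0) (BRight t) s (integrable_dotv_derive1_oc t tL).
have itE := @Rintegral_itv_bndo_bndc R (BRight s) t p ip.
rewrite /length_bound itE -itB ?bnd_simp ?(ltW st)//.
set It := Rintegral _ _ _; set Is := Rintegral _ _ _.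
rewrite -EFinD [fine _]/= le_eqVlt; apply/orP; left; apply/eqP.
by ring.
Qed.

End perturbed_curve.

(** * Rescaling of time, clamping, and bounds for test fields *)

Definition divr_by {R : realType} (c t : R) : R := t / c.

Lemma measurable_divr_by {R : realType} (c : R) :
  measurable_fun setT (divr_by c).
Proof. exact: mulrr_measurable. Qed.

(** By uniqueness of Lebesgue measure: the image measure under t / c, scaled by 1 / c, gives each
    half-open interval its length. *)
Lemma lebesgue_measure_divr_by {R : realType} (c : R) (c0 : 0 < c)
    (A : set (measurableTypeR R)) : measurable A ->
  lebesgue_measure A = (c^-1%:E * lebesgue_measure (divr_by c @^-1` A))%E.
Proof.
move=> mA; have ci0 : 0 <= c^-1 by rewrite invr_ge0 ltW.
have mf := @measurable_divr_by R c.
pose m : {measure set (measurableTypeR R) -> \bar R} :=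
  mscale (NngNum ci0)
    (@measure_function_pushforward__canonical__measure_function_Measure
      _ _ _ (measurableTypeR R) _ (@lebesgue_measure R) _ mf).
suff mE X : ocitv X -> lebesgue_measure X = m X.
  exact: (@lebesgue_measure_unique R m mE A mA).
move=> [[a b] _ <-] /=; rewrite /m /mscale/= /pushforward.
have -> : divr_by c @^-1` `]a, b] = `]a * c, b * c]%classic.
  apply/seteqP; split=> t; rewrite /divr_by/= !in_itv/=.
    by rewrite ltr_pdivlMr// ler_pdivrMr.
  by rewrite ltr_pdivlMr// ler_pdivrMr.
rewrite !lebesgue_measure_itv/= !lte_fin ltr_pM2r//.
case: ifPn => _; last by rewrite mule0.
by rewrite -!EFinB -EFinM -mulrBl mulrC mulfK// gt_eqF.
Qed.

Lemma ae_lebesgue_divr_by {R : realType} (c : R) (P : R -> Prop) : 0 < c ->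
  {ae (@lebesgue_measure R), forall t, P t} ->
  {ae (@lebesgue_measure R), forall t, P (t / c)}.
Proof.
move=> c0 [N [mN N0 PN]]; exists (divr_by c @^-1` N); split.
- by rewrite -[X in measurable X]setTI; exact: measurable_divr_by.
- have := lebesgue_measure_divr_by c c0 N mN; rewrite N0 => /esym/eqP.
  by rewrite mule_eq0 eqe invr_eq0 gt_eqF//= => /eqP.
- by move=> t Pt; exact: PN.
Qed.

Lemma derive1_divr_by {R : realType} {V : normedModType R} (f : R -> V) (c t : R) :
  0 < c -> derivable f (t / c) 1 ->
  derivable (f \o divr_by c) t 1 /\
  derive1 (f \o divr_by c) t = c^-1 *: derive1 f (t / c).
Proof.
move=> c0 ft.
have fl : h^-1 *: (f (h + t / c) - f (t / c)) @[h --> 0^'] --> derive1 f (t / c).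
  move: ft; rewrite /derivable /derive1; set q := (fun h => _).
  by rewrite (_ : q = fun h => h^-1 *: (f (h + t / c) - f (t / c)))//;
    apply/funext => h; rewrite /q/= [h%:A]mulr1.
have ql : h^-1 *: ((f \o divr_by c) (h + t) - (f \o divr_by c) t) @[h --> 0^'] -->
    c^-1 *: derive1 f (t / c).
  (* The quotient at h is 1 / c times the quotient of f at h / c. *)
  rewrite (_ : (fun h => _) = fun h => c^-1 *:
      ((h / c)^-1 *: (f (h / c + t / c) - f (t / c)))); last first.
    apply/funext => h; rewrite /divr_by/= mulrDl scalerA invfM invrK.
    by rewrite mulrCA mulVf ?mulr1// gt_eqF.
  apply: cvgZl_tmp.
  apply: (@cvg_comp _ _ _ (fun h => h / c) (fun h => h^-1 *: (f (h + t / c) - f (t / c)))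
    _ _ _ _ fl).
  move=> A [e /= e0 eA]; exists (e * c) => /=; first by rewrite mulr_gt0.
  move=> h /=; rewrite sub0r normrN => he h0; apply: eA; last first.
    by rewrite mulf_neq0// invr_eq0 gt_eqF.
  by rewrite /= sub0r normrN normrM [`|c^-1|]gtr0_norm ?invr_gt0// ltr_pdivrMr.
split; last exact: cvg_lim ql.
apply/cvg_ex; exists (c^-1 *: derive1 f (t / c)).
rewrite (_ : (fun h => _) =
    fun h => h^-1 *: ((f \o divr_by c) (h + t) - (f \o divr_by c) t))//.
by apply/funext => h; rewrite /= [h%:A]mulr1.
Qed.

(* [g \o clamp L] is a globally Lipschitz curve which agrees with g on [0, L]. *)
Definition clamp {R : realType} (L t : R) : R := Num.max 0 (Num.min t L).

Lemma clamp_id {R : realType} (L t : R) : 0 <= t <= L -> clamp L t = t.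
Proof. by move=> /andP[t0 tL]; rewrite /clamp min_l// max_r. Qed.

Lemma clamp_itv {R : realType} (L t : R) : 0 <= L -> 0 <= clamp L t <= L.
Proof.
move=> L0; rewrite /clamp; case: (leP t L) => tL.
  by case: (leP 0 t) => t0; rewrite ?t0 ?lexx.
by rewrite max_r// lexx andbT.
Qed.

Lemma clamp_lipschitz {R : realType} (L s t : R) : 0 <= L ->
  `|clamp L s - clamp L t| <= `|s - t|.
Proof.
move=> L0; wlog st : s t / s <= t => [H|].
  by have [st|/ltW ts] := leP s t; [exact: H|rewrite distrC (distrC s); exact: H].
rewrite distrC (distrC s) (ger0_norm (x := t - s)) ?subr_ge0// ler_norml.
rewrite /clamp /Num.max /Num.min.
by repeat case: ifPn; rewrite -?leNgt => *; apply/andP; split; lra.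
Qed.

Lemma lipschitz_clamp {R : realType} {d : nat} (L : R) (g : R -> 'rV[R]_d) :
  0 <= L -> [lipschitz g t | t in `[0, L]] ->
  exists K, forall s t, `|g (clamp L s) - g (clamp L t)| <= K * `|s - t|.
Proof.
(* The Lipschitz predicate gives the bound for constants strictly above K, hence [|K| + 1]. *)
move=> L0 [K [Kr gK]]; exists (`|K| + 1) => s t.
have := gK (`|K| + 1); rewrite (le_lt_trans (ler_norm K)) ?ltrDl// => /(_ isT).
move=> /(_ (clamp L s, clamp L t)) /=; rewrite !in_itv/= !clamp_itv//.
move=> /(_ (conj isT isT)) h; rewrite (le_trans h)// ler_wpM2l// ?clamp_lipschitz//.
Qed.

Lemma near_clamp {R : realType} (L t : R) : `]0, L[%classic t ->
  \near t, clamp L t = t.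
Proof.
move=> tL; near=> s; apply: clamp_id.
have : s \in `]0, L[ by near: s; exact: near_in_itvoo.
by rewrite in_itv/= => /andP[/ltW-> /ltW->].
Unshelve. all: by end_near. Qed.

Lemma derivable_clamp {R : realType} {V : normedModType R} (L t : R) (g : R -> V) :
  `]0, L[%classic t -> derivable g t 1 -> derivable (g \o clamp L) t 1.
Proof.
move=> tL; apply: near_eq_derivable.
by apply: filterS (near_clamp _ _ tL) => s /= ->.
Qed.

Lemma derive1_clamp {R : realType} {V : normedModType R} (L t : R) (g : R -> V) :
  `]0, L[%classic t -> derive1 (g \o clamp L) t = derive1 g t.
Proof.
move=> tL; rewrite !derive1E; apply: near_eq_derive.
by apply: filterS (near_clamp _ _ tL) => s /= ->.
Qed.

(** The continuous function |phi'| attains its maximum on [0, L]. Near any point outside, phi is 0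
    because it vanishes off a compact subset of ]0, L[, so phi' = 0 there. *)
Lemma C1c_bound {R : realType} {d : nat} (L : R) (phi : R -> 'rV[R]_d) : 0 <= L ->
  C1c 0 L phi -> exists M, [/\ 0 <= M, forall t, enorm (derive1 phi t) <= M &
    forall s t, `|phi s - phi t| <= M * `|s - t|].
Proof.
move=> L0 [phi_diff phi_C1 [C [Cc CL phi0]]].
have ec : continuous (fun t => enorm (derive1 phi t)).
  move=> t; apply: (@continuous_comp _ _ _ (derive1 phi) (@enorm R d)).
    exact: phi_C1.
  exact: enorm_continuous.
have [c _ cM] : exists2 c, c \in `[0, L] & forall t, t \in `[0, L] ->
    enorm (derive1 phi t) <= enorm (derive1 phi c).
  by apply: EVT_max => //; exact: continuous_subspaceT.
have M0 := enorm_ge0 (derive1 phi c).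
have phiM t : enorm (derive1 phi t) <= enorm (derive1 phi c).
  have [|tL] := boolP (t \in `[0, L]); first exact: cM.
  suff -> : derive1 phi t = 0 by rewrite /enorm /dotv big1 ?sqrtr0// => i _; rewrite mxE mul0r.
  have Ct : nbhs t (~` C).
    apply: open_nbhs_nbhs; split.
      by apply: closed_openC; apply: compact_closed => //; exact: Rhausdorff.
    move=> /CL /=; rewrite in_itv/= => /andP[t0 tl].
    by move/negP: tL; apply; rewrite in_itv/= !ltW.
  rewrite derive1E (@near_eq_derive _ _ _ phi (cst 0)) ?derive_cst//.
  by apply: filterS Ct => s /phi0.
exists (enorm (derive1 phi c)); split => //.
(* The mean value theorem is applied to each coordinate; the sup norm keeps the same constant. *)
have le_st s t : s < t -> `|phi t - phi s| <= enorm (derive1 phi c) * (t - s).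
  move=> st; rewrite [leLHS]/Num.Def.normr/= mx_normrE.
  apply/bigmax_leP; split=> [|[k i] _ /=]; first by rewrite mulr_ge0// subr_ge0 ltW.
  rewrite ord1 !mxE.
  have phii (r : R) : is_derive r 1 (fun t => phi t ord0 i) (derive1 phi r ord0 i).
    have /derivable_mxP/(_ ord0 i) di := phi_diff r.
    by apply: DeriveDef => //; rewrite derive1E derive_mx// mxE.
  have [] := MVT st (fun r _ => phii r).
    apply: continuous_subspaceT => r; apply: differentiable_continuous.
    by apply/derivable1_diffP; exact: ex_derive.
  move=> r _ ->; rewrite normrM [`|t - s|]gtr0_norm ?subr_gt0//.
  apply: ler_wpM2r; first by rewrite subr_ge0 ltW.
  apply: le_trans (coord_le_norm _ _) _.
  exact: le_trans (norm_le_enorm _) (phiM r).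
move=> s t; have [st|ts|->] := ltgtP s t; last by rewrite !subrr !normr0 mulr0.
  by rewrite distrC (distrC s) [`|t - s|]gtr0_norm ?subr_gt0// le_st.
by rewrite [`|s - t|]gtr0_norm ?subr_gt0// le_st.
Qed.

(** * Competitors of an arc-length parameterized curve *)

Section arc_length_curve.
Context {R : realType} {d : nat}.
Variables (L : R) (gamma : R -> 'rV[R]_d).
Hypothesis gammaC : isCurve L gamma.
Hypothesis gamma_arc : arcLengthParam L gamma.

Let g := gamma \o clamp L.

Let L0 : 0 <= L. Proof. by case: gammaC. Qed.

Lemma clamped_unit_speed : {ae (@lebesgue_measure R), forall t, `]0, L[%classic t ->
  derivable g t 1 /\ enorm (derive1 g t) = 1}.
Proof.
apply: ae_lebesgueS gamma_arc => t gt tL; have [dg g1] := gt tL.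
by split; [exact: derivable_clamp|rewrite derive1_clamp].
Qed.

(** Unit speed makes L the integral of |g'|, which is at most the length. The clamped curve g
    supplies a Lipschitz bound on the whole line. *)
Lemma arc_length_le_curveLength : (L%:E <= curveLength L gamma)%E.
Proof.
have := L0; rewrite le_eqVlt => /predU1P[<-|L_gt0]; first exact: curveLength_ge0.
have [K gK] : exists K, forall s t, `|g s - g t| <= K * `|s - t|.
  by case: gammaC => _ glip _; exact: lipschitz_clamp.
have gdiff : {ae (@lebesgue_measure R), forall t, `]0, L[%classic t -> derivable g t 1}.
  by apply: ae_lebesgueS clamped_unit_speed => t gt /gt[].
have -> : curveLength L gamma = curveLength L g.
  rewrite /curveLength; congr ereal_sup; apply/seteqP.
  have E s : itv_partition 0 L s -> evariation 0 L gamma s = evariation 0 L g s.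
    by move=> sP; apply: (eq_evariation _ _ _ _ _ sP) => t tL; rewrite /g/= clamp_id.
  by split=> _ [s sP <-]; exists s => //; rewrite E.
apply: le_trans (lipschitz_enorm_integral g K 0 L gK L_gt0 gdiff).
rewrite (_ : L%:E = \int[@lebesgue_measure R]_(t in `]0%R, L[) (cst 1%E t))%E; last first.
  by rewrite integral_cst//= lebesgue_measure_itv/= lte_fin L_gt0 mul1e sube0.
rewrite le_eqVlt; apply/orP; left; apply/eqP; apply: ae_eq_integral => //.
  apply/measurable_EFinP; apply: measurable_funTS.
  apply: (measurable_derive1_comp g); last exact: enorm_continuous.
  exact: lipschitz_fun_continuous gK.
by apply: ae_lebesgueS clamped_unit_speed => t gt /gt[_ ->].
Qed.

Lemma integrable_derive1_coord i : (@lebesgue_measure R).-integrable `]0, L[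
  (fun t => (derive1 gamma t ord0 i)%:E).
Proof.
have [K gK] : exists K, forall s t, `|g s - g t| <= K * `|s - t|.
  by case: gammaC => _ glip _; exact: lipschitz_clamp.
apply: (@eq_integrable _ _ R (@lebesgue_measure R) `]0, L[ (measurable_itv _)
    (EFin \o (fun t => derive1 g t ord0 i))).
  by move=> t; rewrite inE => tL; rewrite /= derive1_clamp.
apply: (itv_ae_bounded_integrable 1).
  apply: measurable_funTS.
  apply: (measurable_derive1_comp g _ (fun v : 'rV[R]_d => v ord0 i)).
    exact: lipschitz_fun_continuous gK.
  exact: coord_continuous.
apply: ae_lebesgueS clamped_unit_speed => t gt /gt[_ <-].
exact: le_trans (coord_le_norm _ _) (norm_le_enorm _).
Qed.

Variable phi : R -> 'rV[R]_d.
Hypothesis phiC1c : C1c 0 L phi.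
Hypothesis phi1 : forall t, enorm (phi t) <= 1.

Let p t := dotv (derive1 gamma t) (derive1 phi t).

Lemma integrable_derive1_test : (@lebesgue_measure R).-integrable `]0, L[ (EFin \o p).
Proof.
have [K gK] : exists K, forall s t, `|g s - g t| <= K * `|s - t|.
  by case: gammaC => _ glip _; exact: lipschitz_clamp.
have [M [M0 phiM philip]] := C1c_bound L phi L0 phiC1c.
have [phi_diff phi_C1 _] := phiC1c.
apply: (@eq_integrable _ _ R (@lebesgue_measure R) `]0, L[ (measurable_itv _)
    (EFin \o (fun t => dotv (derive1 g t) (derive1 phi t)))).
  by move=> t; rewrite inE => tL; rewrite /= /p derive1_clamp.
exact: (integrable_dotv_derive1 g phi K M L gK clamped_unit_speed phiM phi_C1).
Qed.

(** The constant M is chosen before e, so the quadratic error in the length is negligible as e tends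
    to 0. *)
Lemma competitor_curve : exists M, forall e, 0 < e -> exists a f,
  [/\ isCurve a f,
      (curveLength a f <= (L + e ^+ 2 * M ^+ 2 / 2 * L -
         e * \int[@lebesgue_measure R]_(t in `]0, L[) p t)%:E)%E &
      forall s, 0 <= s <= L -> exists2 t, 0 <= t <= a & enorm (gamma s - f t) <= e].
Proof.
have [K gK] : exists K, forall s t, `|g s - g t| <= K * `|s - t|.
  by case: gammaC => _ glip _; exact: lipschitz_clamp.
have [M [M0 phiM philip]] := C1c_bound L phi L0 phiC1c.
have [phi_diff phi_C1 _] := phiC1c.
exists M => e e_gt0; have e0 := ltW e_gt0.
have c0 : 0 < 1 + e * M by rewrite ltr_pwDl// mulr_ge0.
(* This c bounds |g'| + e |phi'|, so f run at speed 1 / c on [0, c L] is admissible. *)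
set c := 1 + e * M in c0.
pose f := perturbed g phi e.
have fK := perturbed_lipschitz g phi K M e gK philip e0.
exists (c * L), (f \o divr_by c); split.
- split.
  + by rewrite mulr_ge0// ltW.
  + exists ((K + e * M) * c^-1); split; rewrite ?num_real// => N kN -[s t] _ /=.
    apply: (@le_trans _ _ ((K + e * M) * c^-1 * `|s - t|)); last first.
      by rewrite ler_wpM2r// ltW.
    rewrite (le_trans (fK _ _))// -mulrA /divr_by -mulrBl normrM.
    by rewrite [`|c^-1|]gtr0_norm ?invr_gt0// (mulrC `|s - t|).
  + have := ae_lebesgue_divr_by c _ c0 clamped_unit_speed.
    apply: ae_lebesgueS => t gt; rewrite /= in_itv/= => /andP[t0 tcL].
    have tc : `]0, L[%classic (t / c).
      by rewrite /= in_itv/= divr_gt0// ltr_pdivrMr// mulrC.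
    have [dg g1] := gt tc.
    have [df dfE] := perturbed_derive g phi e (t / c) dg (phi_diff _).
    have [dfc ->] := derive1_divr_by f c t c0 df.
    split=> //; rewrite enormZ gtr0_norm ?invr_gt0// dfE perturbedE.
    rewrite mulrC ler_pdivrMr// mul1r (le_trans (ler_enormD _ _))// enormN enormZ g1.
    by rewrite lerD2l ger0_norm// ler_wpM2l.
- apply: ge_ereal_sup => _ [s sP <-]; rewrite lee_fin.
  (* The control function of f, read at time t / c, controls the slowed curve. *)
  pose k t := length_bound g phi M e (t / c).
  have -> : L + e ^+ 2 * M ^+ 2 / 2 * L - e * \int[@lebesgue_measure R]_(t in `]0, L[) p t =
      k (c * L) - k 0.
    rewrite /k mul0r [c * L]mulrC mulfK ?gt_eqF// /length_bound mulr0.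
    rewrite set_itvoc0 Rintegral_set0 mulr0 subrr subr0 mulrDl mul1r.
    have ig := integrable_dotv_derive1 g phi K M L gK clamped_unit_speed phiM phi_C1.
    have -> // : \int[@lebesgue_measure R]_(t in `]0, L[) p t =
        \int[@lebesgue_measure R]_(t in `]0, L]) dotv (derive1 g t) (derive1 phi t).
    rewrite -[RHS](@Rintegral_itv_bndo_bndc R (BRight 0) L _ ig).
    by apply: eq_Rintegral => t; rewrite inE => tL; rewrite /p derive1_clamp.
  apply: (evariation_le_increment k _ _ _ _ sP) => x y x0 xy yL.
  apply: (enorm_perturbed_le g phi K M L e gK clamped_unit_speed philip) => //.
  + by rewrite divr_ge0// ltW.
  + by rewrite ltr_pM2r ?invr_gt0.
  + by rewrite ler_pdivrMr// mulrC.
(* At time c s the slowed curve is at f s, displaced from gamma s by e phi(s). *)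
- move=> s sL; exists (c * s).
    by case/andP: sL => s0 sL; rewrite mulr_ge0 ?(ltW c0)//= ler_pM2l.
  rewrite /= /divr_by [c * s]mulrC mulfK ?gt_eqF// /f perturbedE /g/= clamp_id//.
  by rewrite opprB addrCA subrr addr0 enormZ ger0_norm// ler_piMr.
Qed.

End arc_length_curve.

(** * Distance functions and the support *)

(* MathComp-Analysis has another [edist]. *)
Local Notation edist := Defs.edist.

Section distance_to_set.
Context {R : realType} {d : nat}.
Implicit Types (x y : 'rV[R]_d) (A B : set 'rV[R]_d).

Lemma edist_ge0 x A : 0 <= edist x A.
Proof.
(* The infimum of the empty set has the default value 0. *)
have [->|/set0P[y Ay]] := eqVneq A set0; first by rewrite /edist image_set0 inf0.
apply: lb_le_inf; first by exists (enorm (x - y)), y.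
by move=> _ [z _ <-]; exact: enorm_ge0.
Qed.

Lemma edist_le x y A : A y -> edist x A <= enorm (x - y).
Proof.
move=> Ay; apply: ge_inf; last by exists y.
by exists 0 => _ [z _ <-]; exact: enorm_ge0.
Qed.

Lemma edist_perturb x A B e : A !=set0 ->
  (forall y, A y -> exists2 z, B z & enorm (y - z) <= e) ->
  edist x B <= edist x A + e.
Proof.
move=> [y0 Ay0] AB; rewrite -lerBlDr; apply: lb_le_inf.
  by exists (enorm (x - y0)), y0.
move=> _ [y Ay <-]; have [z Bz yz] := AB y Ay.
rewrite lerBlDr (le_trans (edist_le x z B Bz))//.
by rewrite (le_trans (ler_enorm_tri _ y _))// lerD2l.
Qed.

(** The distance is 1-Lipschitz for [enorm], and [enorm] is continuous in the sup-norm topology. *)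
Lemma edist_continuous A : A !=set0 -> continuous (fun x => edist x A).
Proof.
move=> A0 x; apply/(@cvgrPdist_lt _ _ _ (nbhs x) (nbhs_filter x)) => e e0.
have dlip y z : edist z A <= edist y A + enorm (y - z).
  have [a Aa] := A0; rewrite -lerBlDr; apply: lb_le_inf.
    by exists (enorm (y - a)), a.
  move=> _ [b Ab <-]; rewrite lerBlDr (le_trans (edist_le z b A Ab))//.
  by rewrite (le_trans (ler_enorm_tri _ y _))// enormB addrC.
have : enorm (x - y) @[y --> x] --> 0.
  have -> : 0 = enorm (x - x).
    by rewrite subrr /enorm /dotv big1 ?sqrtr0// => i _; rewrite mxE mul0r.
  apply: (@cvg_comp _ _ _ (fun y => x - y) (@enorm R d) (nbhs x) (nbhs (x - x))).
    by apply: cvgB; [exact: cvg_cst|exact: cvg_id].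
  exact: enorm_continuous.
move/(@cvgrPdist_lt _ _ _ (nbhs x) (nbhs_filter x)) => /(_ e e0); apply: filterS => y.
rewrite sub0r normrN ger0_norm ?enorm_ge0// => xy.
rewrite ltr_norml; apply/andP; split.
  by have := dlip x y; lra.
by have := dlip y x; rewrite enormB; lra.
Qed.

(** Open intervals generate the Borel sets of R, and their preimages are open, hence in
    [borel_rV]. *)
Lemma continuous_borel_measurable (f : 'rV[R]_d -> R) : continuous f ->
  measurable_fun setT (f : borel_rV R d -> R).
Proof.
move=> /continuousP cf; apply: (measurability _ (RGenOpens.measurableE R)).
move=> _ [_ [a [b ->] <-]]; rewrite setTI; apply: sub_sigma_algebra.
exact/cf/interval_open.
Qed.

Lemma measurable_edist_powR A (p : R) : A !=set0 ->
  measurable_fun setT (fun x : borel_rV R d => ((edist x A) `^ p)%:E).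
Proof.
move=> A0; apply/measurable_EFinP.
apply: (measurableT_comp (measurable_powR p)).
exact: continuous_borel_measurable (edist_continuous _ A0).
Qed.

End distance_to_set.

(** * The support of the measure and its diameter *)

Section support.
Context {R : realType} {d : nat}.
Variable mu : {finite_measure set (borel_rV R d) -> \bar R}.

Lemma open_measurable_rV (U : set 'rV[R]_d) : open U -> measurable (U : set (borel_rV R d)).
Proof. exact: sub_sigma_algebra. Qed.

(** This provides a base of the topology indexed by a countable type. A radius below r / 2 keeps a
    ball that contains x inside the ball of radius r around x. *)
Lemma rat_ball (x : 'rV[R]_d) (U : set 'rV[R]_d) : open U -> U x ->
  exists (q : 'rV[rat]_d) (k : nat), ball (map_mx ratr q : 'rV[R]_d) k.+1%:R^-1 x /\
    ball (map_mx ratr q : 'rV[R]_d) k.+1%:R^-1 `<=` U.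
Proof.
move=> Uo Ux; have /nbhs_ballP[r /= r0 rU] : nbhs x U by exact: open_nbhs_nbhs.
have [k _ /(_ k (leqnn k)) /= kr] := near_infty_natSinv_lt (PosNum (divr_gt0 r0 (ltr0Sn R 1))).
have k0 : 0 < k.+1%:R^-1 :> R by rewrite invr_gt0.
have /choice[q qx] i : exists q : rat, `|ratr q - x ord0 i| < k.+1%:R^-1.
  have /rat_in_itvoo[q] : x ord0 i - k.+1%:R^-1 < x ord0 i + k.+1%:R^-1.
    by rewrite ltrD2l (lt_trans _ k0)// oppr_lt0.
  by rewrite in_itv/= => qx; exists q; rewrite ltr_distl.
have xq : ball (map_mx ratr (\row_i q i) : 'rV[R]_d) k.+1%:R^-1 x.
  split=> // i j; rewrite ord1 !mxE -ball_normE /=; exact: qx.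
exists (\row_i q i), k; split => // y qy; apply: rU.
apply: (@le_ball _ _ x (k.+1%:R^-1 + k.+1%:R^-1)).
  by rewrite [leRHS]splitr lerD// ltW.
exact: ball_triangle (ball_sym xq) qy.
Qed.

(* Lindelof: the complement of the support is covered by the null balls with
   rational centre and radius 1/(k+1). *)
Lemma ae_supp : {ae mu, forall x, supp mu x}.
Proof.
(* Codes of no pair and balls of nonzero measure contribute the empty set, so every [B n] is
   null. *)
pose B (n : nat) : set (borel_rV R d) :=
  if unpickle n is Some (q, k) then
    let b := ball (map_mx ratr (q : 'rV[rat]_d) : 'rV[R]_d) (k : nat).+1%:R^-1 in
    if `[< mu b = 0%E >] then b else set0
  else set0.
suff [N [mN N0 BN]] : mu.-negligible (\bigcup_n B n).
  exists N; split=> //; apply: subset_trans BN => x /=.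
  move=> /existsNP[U] /not_implyP[Uo] /not_implyP[Ux muU].
  have mU := open_measurable_rV U Uo.
  have [q [k [xq qU]]] := rat_ball x U Uo Ux.
  exists (pickle (q, k)) => //; rewrite /B pickleK.
  have mb : measurable (ball (map_mx ratr q : 'rV[R]_d) k.+1%:R^-1 : set (borel_rV R d)).
    by apply: open_measurable_rV; exact: ball_open.
  case: ifPn => // /asboolP; apply: contra_notP => _; apply: contra_notP muU => mub.
  apply: lt_le_trans (le_measure mu _ _ qU); rewrite ?inE//.
  by rewrite lt0e measure_ge0 andbT; apply/eqP.
apply: negligible_bigcup => n; rewrite /B.
case: unpickle => [[q k]|]; last exact: negligible_set0.
case: ifPn => [/asboolP mub|_]; last exact: negligible_set0.
by apply/negligibleP => //; apply: open_measurable_rV; exact: ball_open.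
Qed.

Hypothesis mu_gt0 : (0 < mu setT)%E.
Hypothesis supp_compact : compact (supp mu).

(** By [ae_supp], an empty support would make the whole space null. *)
Lemma supp_neq0 : supp mu !=set0.
Proof.
apply/set0P/eqP => s0; have [N [mN N0 sN]] := ae_supp.
have NT : N = setT by apply/seteqP; split=> // x _; apply: sN; rewrite s0.
by move: mu_gt0; rewrite -NT N0 ltxx.
Qed.

(** Compactness bounds the set of distances, so the supremum in [ediam] is a true upper bound. *)
Lemma enorm_le_ediam x y : supp mu x -> supp mu y -> enorm (x - y) <= ediam (supp mu).
Proof.
move=> sx sy; apply: ub_le_sup; last by exists x => //; exists y.
have [M [Mr sM]] := compact_bounded supp_compact.
exists (d%:R * ((M + 1) + (M + 1))) => _ [u su [v sv <-]].
rewrite (le_trans (enorm_le_norm _))// ler_wpM2l//.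
by rewrite (le_trans (ler_normB _ _))// lerD// sM//= ltrDl.
Qed.

Lemma ediam_ge0 : 0 <= ediam (supp mu).
Proof.
by have [x sx] := supp_neq0; exact: le_trans (enorm_ge0 _) (enorm_le_ediam x x sx sx).
Qed.

(** Almost every x lies in the support, hence within the diameter from y. *)
Lemma integral_edist_supp_point (p : R) y : 0 <= p -> supp mu y ->
  (\int[mu]_x ((edist x [set y]) `^ p)%:E <= (ediam (supp mu) `^ p)%:E * mu setT)%E.
Proof.
move=> p0 sy; rewrite -integral_cst//.
apply: ae_ge0_le_integral => //.
- by move=> x _; rewrite lee_fin powR_ge0.
- by apply: measurable_edist_powR; exists y.
- by move=> x _; rewrite /= lee_fin powR_ge0.
apply: (@filterS _ _ (ae_filter_ringOfSetsType mu)) ae_supp => x sx _.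
rewrite lee_fin ge0_ler_powR// ?nnegrE ?edist_ge0 ?ediam_ge0//.
exact: le_trans (edist_le _ _ _ (erefl y)) (enorm_le_ediam _ _ sx sy).
Qed.

End support.

(** * Energy comparison *)

(* Convexity of [r `^ p] at [r + e], a barycentre of [r * (D + e) / D] and [D + e]. *)
Lemma powR_addr_le {R : realType} (p D e r : R) : 1 <= p -> 0 < D -> 0 < e -> 0 <= r ->
  (r + e) `^ p <= ((D + e) / D) `^ (p - 1) * r `^ p + (D + e) `^ (p - 1) * e.
Proof.
move=> p1 D0 e0 r0; have De : 0 < D + e by rewrite addr_gt0.
have p0 : 0 < p by rewrite (lt_le_trans _ p1).
set q := (D + e) / D; have q0 : 0 < q by rewrite divr_gt0.
have w0 : 0 <= q^-1 by rewrite invr_ge0 ltW.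
have w1 : q^-1 <= 1 by rewrite invf_le1// /q ler_pdivlMr// mul1r lerDl ltW.
have cvx : (q^-1 * (r * q) + (1 - q^-1) * (D + e)) `^ p <=
    q^-1 * (r * q) `^ p + (1 - q^-1) * (D + e) `^ p.
  apply: (convex_powR p1 (Itv01 w0 w1)); rewrite inE/= in_itv/= andbT.
    by rewrite mulr_ge0// ltW.
  exact: ltW.
have w1E : (1 - q^-1) * (D + e) = e by rewrite /q; field; rewrite !gt_eqF.
have powRE x : 0 < x -> x `^ p = x * x `^ (p - 1) by move=> x0; rewrite mulr_powRB1// ltW.
move: cvx; rewrite w1E [r * q]mulrC mulKf ?gt_eqF// => /le_trans; apply.
rewrite powRM// ?(ltW q0)// (powRE q)// (powRE (D + e))// [X in _ + X]mulrA w1E.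
rewrite [e * _]mulrC lerD2r le_eqVlt -subr_eq0; apply/orP; left; apply/eqP.
by field; rewrite gt_eqF.
Qed.

Section energy_comparison.
Context {R : realType} {d : nat}.
Variable mu : {finite_measure set (borel_rV R d) -> \bar R}.
Hypothesis hmu : posCompactMeasure mu.
Variables (lambda p L : R) (gamma : R -> 'rV[R]_d).
Hypothesis hlambda : 0 < lambda.
Hypothesis hp : 1 <= p.
Hypothesis hmin : isMinimizer mu lambda p L gamma.

Let D := ediam (supp mu).
Let m := fine (mu setT).
Let Gamma := gamma @` `[0, L].
Let fidelity (A : set 'rV[R]_d) := (\int[mu]_x ((edist x A) `^ p)%:E)%E.

Let muT : mu setT = m%:E.
Proof. by rewrite fineK// fin_num_measure. Qed.

Let m0 : 0 <= m. Proof. exact: fine_ge0. Qed.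

Let D0 : 0 <= D. Proof. by case: hmu => *; exact: ediam_ge0. Qed.

Let L0 : 0 <= L. Proof. by case: hmin => -[]. Qed.

Let p0 : 0 < p. Proof. exact: lt_le_trans hp. Qed.

Let energy_le a f : isCurve a f ->
  (energy mu lambda p L gamma <= energy mu lambda p a f)%E.
Proof.
by move=> fC; case: hmin => _ ->; apply: ereal_inf_lbound; exists (a, f).
Qed.

Lemma fidelity_ge0 A : (0 <= fidelity A)%E.
Proof. by apply: integral_ge0 => x _; rewrite lee_fin powR_ge0. Qed.

(** The competitor is a single point of the support, with domain [0, 0] and length 0. For D = 0 the
    bound is 0. *)
Lemma energy_le_diam : (energy mu lambda p L gamma <= (D `^ p * m)%:E)%E.
Proof.
case: hmu => mu0 cs; have [y sy] := supp_neq0 mu mu0.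
have yC : isCurve 0 (cst y).
  split=> //.
  - exists 0; split; rewrite ?num_real// => N N0 [s t] _ /=.
    by rewrite subrr normr0 mulr_ge0// ltW.
  - by apply: aeW => t; rewrite /= in_itv/= => /andP[/lt_trans] /[apply]; rewrite ltxx.
apply: (le_trans (energy_le _ _ yC)); rewrite /energy.
rewrite set_itv1 image_set1.
have -> : curveLength 0 (cst y : R -> 'rV[R]_d) = 0%E.
  by apply/eqP; rewrite eq_le curveLength_cst curveLength_ge0.
rewrite mule0 adde0 EFinM -muT.
by apply: integral_edist_supp_point => //; exact: ltW.
Qed.

Let Gamma0 : Gamma !=set0.
Proof. by exists (gamma 0), 0 => //=; rewrite in_itv/= lexx. Qed.

Lemma fidelity_Gamma_le : (fidelity Gamma <= (D `^ p * m)%:E)%E.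
Proof.
apply: le_trans energy_le_diam; rewrite /energy leeDl// mule_ge0//.
  by rewrite lee_fin ltW.
exact: curveLength_ge0.
Qed.

(** Let I be the fidelity of Gamma. Integrating [powR_addr_le] gives A I + (D + e)^(p-1) e m. As A
    >= 1, (A - 1) I <= (A - 1) D^p m, and A D^p = (D + e)^(p-1) D. *)
Lemma fidelity_perturb e B : 0 < D -> 0 < e ->
  (forall y, Gamma y -> exists2 z, B z & enorm (y - z) <= e) ->
  (fidelity B <= fidelity Gamma + (((D + e) `^ p - D `^ p) * m)%:E)%E.
Proof.
move=> D_gt0 e0 GB; set A := ((D + e) / D) `^ (p - 1).
have e_ge0 := ltW e0.
have De : 0 < D + e by rewrite addr_gt0.
have B0 : B !=set0.
  by case: Gamma0 => y Gy; have [z Bz _] := GB y Gy; exists z.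
have mG := measurable_edist_powR Gamma p Gamma0.
apply: (@le_trans _ _ (\int[mu]_x (A%:E * ((edist x Gamma) `^ p)%:E +
    ((D + e) `^ (p - 1) * e)%:E))%E).
  apply: ge0_le_integral => //.
  - by move=> x _; rewrite lee_fin powR_ge0.
  - exact: measurable_edist_powR.
  - apply: emeasurable_funD; last exact: measurable_cst.
    exact: emeasurable_funM.
  - move=> x _; rewrite -EFinM -EFinD lee_fin.
    apply: (le_trans _ (powR_addr_le _ _ _ _ hp D_gt0 e0 (edist_ge0 x Gamma))).
    rewrite ge0_ler_powR ?nnegrE ?edist_ge0 ?addr_ge0 ?edist_ge0 ?(ltW e0) ?(ltW p0)//.
    exact: edist_perturb.
rewrite ge0_integralD//; last 3 first.
- by move=> x _; rewrite -EFinM lee_fin mulr_ge0 ?powR_ge0.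
- exact: emeasurable_funM.
- by move=> x _; rewrite lee_fin mulr_ge0 ?powR_ge0.
rewrite ge0_integralZl//; last 2 first.
- by move=> x _; rewrite lee_fin powR_ge0.
- by rewrite lee_fin powR_ge0.
rewrite integral_cst//= muT -/(fidelity Gamma).
have IfinN : fidelity Gamma \is a fin_num.
  by rewrite ge0_fin_numE ?fidelity_ge0// (le_lt_trans fidelity_Gamma_le)// ltry.
have := fidelity_Gamma_le; rewrite -(fineK IfinN).
move: (fine _) => I; rewrite -!EFinM -!EFinD !lee_fin => ID.
have A1 : 1 <= A.
  apply: (@le_trans _ _ (1 `^ (p - 1))); first by rewrite powR1.
  rewrite ge0_ler_powR ?nnegrE ?subr_ge0//.
    by rewrite divr_ge0// ltW.
  by rewrite ler_pdivlMr// mul1r lerDl ltW.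
have AD : A * D `^ p = (D + e) `^ (p - 1) * D.
  rewrite -(mulr_powRB1 D0 p0) mulrCA -powRM ?divr_ge0 ?(ltW De)//.
  by rewrite divfK ?gt_eqF// mulrC.
have DeP : (D + e) `^ p = (D + e) `^ (p - 1) * (D + e).
  by rewrite mulrC mulr_powRB1// ltW.
rewrite DeP; have : (A - 1) * I <= (A - 1) * (D `^ p * m).
  by rewrite ler_wpM2l// subr_ge0.
have -> : (A - 1) * (D `^ p * m) = (A * D `^ p - D `^ p) * m by ring.
rewrite AD => AI; suff -> : A * I = (A - 1) * I + I.
  rewrite -subr_ge0 in AI; rewrite -subr_ge0 (le_trans AI)// le_eqVlt.
  by apply/orP; left; apply/eqP; ring.
by rewrite mulrBl mul1r subrK.
Qed.

End energy_comparison.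

(** * The first variation inequality and its limit *)

Section first_variation.
Context {R : realType} {d : nat}.
Variable mu : {finite_measure set (borel_rV R d) -> \bar R}.
Hypothesis hmu : posCompactMeasure mu.
Variables (lambda p L : R) (gamma : R -> 'rV[R]_d).
Hypothesis hlambda : 0 < lambda.
Hypothesis hp : 1 <= p.
Hypothesis hmin : isMinimizer mu lambda p L gamma.
Hypothesis harc : arcLengthParam L gamma.
Variable phi : R -> 'rV[R]_d.
Hypothesis phiC1c : C1c 0 L phi.
Hypothesis phi1 : forall t, enorm (phi t) <= 1.

Let D := ediam (supp mu).
Let m := fine (mu setT).
Let J := \int[@lebesgue_measure R]_(t in `]0, L[) dotv (derive1 gamma t) (derive1 phi t).

Let gammaC : isCurve L gamma. Proof. by case: hmin. Qed.

Let fid := (\int[mu]_x ((edist x (gamma @` `[0, L])) `^ p)%:E)%E.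

Let fid_fin : fid \is a fin_num.
Proof.
have := fidelity_Gamma_le mu hmu lambda p L gamma hlambda hp hmin.
have := fidelity_ge0 mu p (gamma @` `[0, L]).
by rewrite -/fid => f0 fD; rewrite ge0_fin_numE// (le_lt_trans fD)// ltry.
Qed.

Let energy_ge : (fid + (lambda * L)%:E <= energy mu lambda p L gamma)%E.
Proof.
rewrite /energy leeD2l// EFinM lee_pmul2l ?lte_fin//.
exact: arc_length_le_curveLength.
Qed.

(** In the comparison of gamma with the competitor, the finite fidelity and lambda L occur on both
    sides and cancel. *)
Lemma energy_first_variation : 0 < D -> exists M, forall e, 0 < e ->
  lambda * (e * J) <= ((D + e) `^ p - D `^ p) * m + lambda * (e ^+ 2 * M ^+ 2 / 2 * L).
Proof.
move=> D_gt0; have [M competitor] := competitor_curve L gamma gammaC harc phi phiC1c phi1.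
exists M => e e0; have [a [f [fC fL fG]]] := competitor e e0.
have fidP : (\int[mu]_x ((edist x (f @` `[0, a])) `^ p)%:E <=
    fid + (((D + e) `^ p - D `^ p) * m)%:E)%E.
  apply: (fidelity_perturb mu hmu lambda p L gamma hlambda hp hmin) => //.
  move=> _ [s sL <-]; have [|t ta st] := fG s; first by move: sL; rewrite /= in_itv.
  by exists (f t) => //; exists t; rewrite //= in_itv.
have : (fid + (lambda * L)%:E <= (fid + (((D + e) `^ p - D `^ p) * m)%:E) +
    lambda%:E * (L + e ^+ 2 * M ^+ 2 / 2 * L - e * J)%:E)%E.
  apply: (le_trans energy_ge); apply: (@le_trans _ _ (energy mu lambda p a f)).
    by case: hmin => _ ->; apply: ereal_inf_lbound; exists (a, f).
  by rewrite /energy leeD// lee_pmul2l ?lte_fin.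
rewrite -(fineK fid_fin) -EFinM -!EFinD lee_fin.
move: (fine fid) => F; rewrite -subr_ge0 => h; rewrite -subr_ge0 (le_trans h)//.
by rewrite le_eqVlt; apply/orP; left; apply/eqP; ring.
Qed.

(** Dividing by e = 1 / (n + 1) turns the fidelity term into a difference quotient of r^p at D,
    while the quadratic term tends to 0. *)
Lemma bv_test_bound : J <= p / lambda * D `^ (p - 1) * m.
Proof.
have m0 : 0 <= m by exact: fine_ge0.
have p0 : 0 < p := lt_le_trans ltr01 hp.
have [[mu0 cs] [[L0 _ _] _]] := (hmu, hmin).
have D0 : 0 <= D by exact: ediam_ge0.
move: L0; rewrite le_eqVlt => /predU1P[L0|L_gt0].
  rewrite /J -L0 set_itvoo0 Rintegral_set0 !mulr_ge0 ?invr_ge0 ?powR_ge0//; exact: ltW.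
(* If D = 0, comparison with a constant curve gives energy at most 0, but it is at least lambda L >
   0. *)
have D_gt0 : 0 < D.
  rewrite lt_neqAle D0 andbT eq_sym; apply/eqP => D_eq0.
  have := energy_le_diam mu hmu lambda p L gamma hp hmin.
  rewrite -/D D_eq0 powR0 ?gt_eqF// mul0r; apply/negP; rewrite -ltNge.
  apply: lt_le_trans energy_ge; rewrite -(fineK fid_fin) -EFinD lte_fin.
  rewrite ltr_wpDl ?mulr_gt0// fine_ge0//; exact: fidelity_ge0.
have [M var] := energy_first_variation D_gt0.
have dD : is_derive D 1 (@powR R ^~ p) (p * D `^ (p - 1)) by exact: is_derive1_powR.
pose u (n : nat) : R := n.+1%:R^-1.
have u0 n : 0 < u n by rewrite invr_gt0.
have uc : u n @[n --> \oo] --> 0 by exact: cvg_harmonic.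
have qc : (u n)^-1 * ((D + u n) `^ p - D `^ p) @[n --> \oo] --> p * D `^ (p - 1).
  have h0 : h^-1 *: ((D + h) `^ p - D `^ p) @[h --> 0^'] --> p * D `^ (p - 1).
    have [dp <-] := dD; move: dp; rewrite /derivable /derive; set q := (fun h => _).
    rewrite (_ : q = fun h => h^-1 *: ((D + h) `^ p - D `^ p))//.
    by apply/funext => h; rewrite /q/= [h%:A]mulr1 (addrC h D).
  apply: (@cvg_comp _ _ _ u (fun h => h^-1 *: ((D + h) `^ p - D `^ p)) _ _ _ _ h0).
  move=> A [r /= r0 rA]; have := near_infty_natSinv_lt (PosNum r0).
  apply: filterS => n /= nr; apply: rA; last by rewrite gt_eqF.
  by rewrite /= sub0r normrN gtr0_norm.
have rc : (u n)^-1 * ((D + u n) `^ p - D `^ p) * m + lambda * (u n * M ^+ 2 / 2 * L)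
    @[n --> \oo] --> p * D `^ (p - 1) * m + lambda * (0 * M ^+ 2 / 2 * L).
  apply: cvgD; first exact: cvgMr_tmp.
  by apply: cvgMl_tmp; apply: cvgMr_tmp; apply: cvgMr_tmp; exact: cvgMr_tmp.
have : lambda * J <= p * D `^ (p - 1) * m + lambda * (0 * M ^+ 2 / 2 * L).
  apply: (cvgr_to_ge rc); apply: nearW => n.
  have := var (u n) (u0 n); rewrite -(ler_pM2l (_ : 0 < (u n)^-1)) ?invr_gt0//.
  have un : u n != 0 by rewrite gt_eqF.
  have -> : (u n)^-1 * (lambda * (u n * J)) = lambda * J by field.
  by congr (_ <= _); field.
rewrite !mul0r mulr0 addr0 mulrC -ler_pdivlMr// => /le_trans; apply.
by rewrite le_eqVlt; apply/orP; left; apply/eqP; field; rewrite gt_eqF.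
Qed.

End first_variation.

Theorem proposition4p2 (R : realType) (d : nat) (hd : (2 <= d)%N)
    (mu : {finite_measure set (borel_rV R d) -> \bar R})
    (hmu : posCompactMeasure mu)
    (lambda p : R) (hlambda : 0 < lambda) (hp : 1 <= p)
    (L : R) (gamma : R -> 'rV[R]_d)
    (hmin : isMinimizer mu lambda p L gamma)
    (harc : arcLengthParam L gamma) :
  isBV L (derive1 gamma) /\
  (bvVariation L (derive1 gamma) <=
     (p / lambda * ediam (supp mu) `^ (p - 1))%:E * mu setT)%E.
Proof.
have gammaC : isCurve L gamma by case: hmin.
have bv : (bvVariation L (derive1 gamma) <=
     (p / lambda * ediam (supp mu) `^ (p - 1))%:E * mu setT)%E.
  apply: ge_ereal_sup => _ [phi [phiC1c phi1] <-].
  (* Integrability identifies the extended integral with the real one in [bv_test_bound]. *)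
  have := integrable_derive1_test L gamma gammaC harc phi phiC1c.
  move/integrable_fin_num => /(_ (measurable_itv _)) /fineK <-.
  rewrite -(fineK (fin_num_measure mu setT measurableT)) -EFinM lee_fin.
  exact: (bv_test_bound mu hmu lambda p L gamma hlambda hp hmin harc phi phiC1c phi1).
split=> //; split; first exact: integrable_derive1_coord.
(* The variation is finite because its bound is, mu being finite. *)
apply: (le_lt_trans bv); rewrite -(fineK (fin_num_measure mu setT measurableT)).
by rewrite -EFinM ltry.
Qed.
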